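(* Let $(G,\rho,V)$ be a prehomogeneous vector space. Let $\frac{h_1}{f_1f_2}$ be an additive relative invariant written in lowest terms, with $f_1$ and $f_2$ polynomial relative invariants having no common factors. If $$\frac{h_1}{f_1f_2}=\frac{\alpha}{f_1}+\frac{\beta}{f_2}$$ for $\alpha,\beta$ homogeneous polynomials of the same degree as $f_1$ and $f_2$, respectively, then $\frac{\alpha}{f_1}$ and $\frac{\beta}{f_2}$ are additive relative invariants written in lowest terms.
   Context: A prehomogeneous vector space $(G,\rho,V)$ is a rational representation $\rho:G\to\mathrm{GL}(V)$ of a connected complex linear algebraic group $G$ on a finite-dimensional complex vector space $V$ having a (unique) Zariski open orbit $\Omega\subseteq V$. A relative invariant is a rational function $f$ on $V$, not identically $0$, for which there is a rational character $\chi:G\to\mathbb{G}_m=\mathrm{GL}_1(\mathbb{C})$ with $f(\rho(g)(v))=\chi(g)f(v)$ for all $v\in\Omega$, $g\in G$ (polynomial relative invariants are automatically homogeneous). An additive relative invariant is a rational function $h$ on $V$ for which there is a homomorphism of algebraic groups $\Phi:G\to\mathbb{G}_a=(\mathbb{C},+)$ with $h(\rho(g)(v))-h(v)=\Phi(g)$ for all $v\in\Omega$, $g\in G$. *)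

(* Defs.v *)
From HB Require Import structures.
From mathcomp Require Import all_boot all_order all_algebra.
From mathcomp Require Import complex.
From mathcomp Require Import reals.
From mathcomp Require Import mpoly.

Set Implicit Arguments.
Unset Strict Implicit.
Unset Printing Implicit Defensive.

Import GRing.Theory.
Local Open Scope ring_scope.

Notation "x %:F" := (@FracField.tofrac _ x) : ring_scope.

(* An unspecified [R : realType] is the field of real numbers, so [R[i]] is
   the field of complex numbers. *)
Section Prehomogeneous.
Variable R : realType.
Local Notation C := R[i].

Definition zero_locus N (S : {mpoly C[N]} -> Prop) (x : 'I_N -> C) : Prop :=
  forall p, S p -> p.@[x] = 0.

Definition entries m (g : 'M[C]_m) : 'I_(m * m) -> C := mxvec g 0.

Definition coords n (v : 'cV[C]_n) : 'I_n -> C := fun i => v i 0.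

Definition zariski_open n (U : 'cV[C]_n -> Prop) : Prop :=
  exists S : {mpoly C[n]} -> Prop,
    forall v, U v <-> ~ zero_locus S (coords v).

(* Linear algebraic groups are the Zariski closed subgroups of GL_m(C). *)
Definition linear_algebraic_group m (G : 'M[C]_m -> Prop) : Prop :=
  [/\ exists S : {mpoly C[m * m]} -> Prop,
        forall g, G g <-> g \in unitmx /\ zero_locus S (entries g),
      G 1%:M,
      forall g h, G g -> G h -> G (g *m h)
    & forall g, G g -> G (invmx g)].

(* Connectedness in the Zariski topology: G is not the disjoint union of two
   proper closed subsets. *)
Definition zariski_connected m (G : 'M[C]_m -> Prop) : Prop :=
  forall S T : {mpoly C[m * m]} -> Prop,
    (forall g, G g -> zero_locus S (entries g) \/ zero_locus T (entries g)) ->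
    (forall g, G g ->
       ~ (zero_locus S (entries g) /\ zero_locus T (entries g))) ->
    (forall g, G g -> zero_locus S (entries g)) \/
    (forall g, G g -> zero_locus T (entries g)).

(* The coordinate ring of a closed subgroup of GL_m is generated by the matrix
   entries and 1 / det. *)
Definition regular_on m (G : 'M[C]_m -> Prop) (f : 'M[C]_m -> C) : Prop :=
  exists (p : {mpoly C[m * m]}) (k : nat),
    forall g, G g -> f g = p.@[entries g] / (\det g) ^+ k.

Definition rational_representation m n (G : 'M[C]_m -> Prop)
    (rho : 'M[C]_m -> 'M[C]_n) : Prop :=
  [/\ forall g, G g -> rho g \in unitmx,
      forall g h, G g -> G h -> rho (g *m h) = rho g *m rho h
    & forall i j, regular_on G (fun g => rho g i j)].

Definition rational_character m (G : 'M[C]_m -> Prop)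
    (chi : 'M[C]_m -> C) : Prop :=
  [/\ forall g, G g -> chi g != 0,
      forall g h, G g -> G h -> chi (g *m h) = chi g * chi h
    & regular_on G chi].

Definition additive_character m (G : 'M[C]_m -> Prop)
    (Phi : 'M[C]_m -> C) : Prop :=
  (forall g h, G g -> G h -> Phi (g *m h) = Phi g + Phi h) /\
  regular_on G Phi.

Definition is_orbit m n (G : 'M[C]_m -> Prop) (rho : 'M[C]_m -> 'M[C]_n)
    (Omega : 'cV[C]_n -> Prop) : Prop :=
  exists v0, forall v, Omega v <-> exists2 g, G g & v = rho g *m v0.

(* The open orbit is carried as the explicit argument [Omega]; it is determined
   by [G] and [rho], since nonempty Zariski open sets meet. *)
Definition prehomogeneous m n (G : 'M[C]_m -> Prop) (rho : 'M[C]_m -> 'M[C]_n)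
    (Omega : 'cV[C]_n -> Prop) : Prop :=
  [/\ linear_algebraic_group G, zariski_connected G,
      rational_representation G rho,
      is_orbit G rho Omega & zariski_open Omega].

(* The rational function [f] is defined at [v], with value [c]. *)
Definition has_value n (f : {fraction {mpoly C[n]}}) (v : 'cV[C]_n)
    (c : C) : Prop :=
  exists p q : {mpoly C[n]},
    [/\ q.@[coords v] != 0, f = p%:F / q%:F
      & c = p.@[coords v] / q.@[coords v]].

Definition relative_invariant m n (G : 'M[C]_m -> Prop)
    (rho : 'M[C]_m -> 'M[C]_n) (Omega : 'cV[C]_n -> Prop)
    (f : {fraction {mpoly C[n]}}) : Prop :=
  f != 0 /\
  exists2 chi, rational_character G chi &
    forall v g, Omega v -> G g ->
      exists a b, [/\ has_value f v a, has_value f (rho g *m v) b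
                    & b = chi g * a].

Definition additive_relative_invariant m n (G : 'M[C]_m -> Prop)
    (rho : 'M[C]_m -> 'M[C]_n) (Omega : 'cV[C]_n -> Prop)
    (h : {fraction {mpoly C[n]}}) : Prop :=
  exists2 Phi, additive_character G Phi &
    forall v g, Omega v -> G g ->
      exists a b, [/\ has_value h v a, has_value h (rho g *m v) b
                    & b - a = Phi g].

Definition no_common_factor n (p q : {mpoly C[n]}) : Prop :=
  forall d p' q' : {mpoly C[n]},
    p = d * p' -> q = d * q' -> d \is a GRing.unit.

End Prehomogeneous.

(* Main.v *)
Require Import Defs.
From HB Require Import structures.
From mathcomp Require Import all_boot all_order all_algebra.
From mathcomp Require Import complex.
From mathcomp Require Import boolp reals.
From mathcomp Require Import mpoly.
From mathcomp Require Import ring.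

(* For fixed [g], put A = chi1(g)^-1 (alpha o rho(g)) - alpha and similarly B
   from beta and chi2. On the open orbit, hence everywhere by density, additive
   invariance of the sum reads  A f2 + B f1 = Phi(g) f1 f2,  so that f1 divides
   A f2. As f1 and f2 have no common factor, f1 divides A, and since
   deg A <= deg f1 the quotient is a constant Phi1(g). This says that alpha / f1
   is changed by rho(g) by the constant Phi1(g), which is therefore additive in
   g, and regular in g because it can be computed at one point of the orbit.
   Lowest terms: a common factor of alpha and f1 divides h1 and f1 f2.

   The divisibility step is Euclid's lemma in C[x_1, ..., x_n], obtained by
   induction on n: Gauss's lemma carries it from a ring in which nonunits have
   prime divisors to the polynomials over that ring. *)

Set Implicit Arguments.
Unset Strict Implicit.
Unset Printing Implicit Defensive.

Import GRing.Theory.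
Local Open Scope ring_scope.

(** * Euclid's lemma for polynomials over a ring *)

Section Divisibility.
Variable A : idomainType.
Implicit Types a b c d p : A.

Definition divides a b := exists c, b = a * c.

Definition prime_element p :=
  [/\ p != 0, p \isn't a GRing.unit &
      forall a b, divides p (a * b) -> divides p a \/ divides p b].

(* On polynomials over C this is convertible to [no_common_factor]. *)
Definition coprime_elements a b :=
  forall d a' b', a = d * a' -> b = d * b' -> d \is a GRing.unit.

Definition euclid_lemma :=
  forall a b c, coprime_elements a b -> divides a (b * c) -> divides a c.

(** What makes the removal of prime factors terminate; the instance used later is [msize]. *)
Definition division_measure (mu : A -> nat) :=
  forall a b, a \isn't a GRing.unit -> a * b != 0 -> (mu b < mu (a * b)%R)%N.

Definition has_prime_divisors :=
  forall a, a != 0 -> a \isn't a GRing.unit ->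
    exists2 p, prime_element p & divides p a.

Lemma divides_trans a b c : divides a b -> divides b c -> divides a c.
Proof. by move=> [x ->] [y ->]; exists (x * y); rewrite mulrA. Qed.

Lemma coprime_divides_unit d a b :
  coprime_elements a b -> divides d a -> divides d b -> d \is a GRing.unit.
Proof. by move=> co [x ax] [y be]; apply: co ax be. Qed.

Lemma coprime_elements_divl a a' b :
  divides a' a -> coprime_elements a b -> coprime_elements a' b.
Proof.
move=> [x ->] co d y z ey ez.
by apply: (co d (y * x) z); rewrite // ey mulrA.
Qed.

Lemma coprime_elements_sym a b : coprime_elements a b -> coprime_elements b a.
Proof. by move=> co d x y ex ey; apply: co ey ex. Qed.

(** Splitting off nonunit factors ends at an irreducible element. If an irreducible [a] does not
    divide [b], the two are coprime, so Euclid's lemma makes [a] prime. *)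
Lemma has_prime_divisors_euclid (mu : A -> nat) :
  division_measure mu -> euclid_lemma -> has_prime_divisors.
Proof.
move=> mu_lt gauss a; have [k] := ubnP (mu a); elim: k a => // k IH a.
rewrite ltnS => le_a a0 aNu.
have [[x [y [exy xNu yNu]]]|irr] := pselect (exists x y,
  [/\ a = x * y, x \isn't a GRing.unit & y \isn't a GRing.unit]).
  have [] := IH x _ _ xNu.
  - apply: leq_trans le_a; rewrite exy mulrC mu_lt // mulrC -exy //.
  - by apply: contraNneq a0; rewrite exy => ->; rewrite mul0r.
  - move=> p pp px; exists p => //.
    by apply: divides_trans px _; exists y.
exists a; last by exists 1; rewrite mulr1.
split=> // b c abc; have [ab|Nab] := pselect (divides a b); first by left.
right; apply: gauss abc => d x y ex ey.
apply/negPn/negP => dNu; apply: Nab.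
have [xu|xNu] := boolP (x \is a GRing.unit); last first.
  by case: irr; exists d, x.
exists (x^-1 * y); rewrite ey ex.
by rewrite -mulrA [x * _]mulrA divrr // mul1r.
Qed.

End Divisibility.

(** * Gauss's lemma and Euclid's lemma for polynomials in one variable *)

Section PolyGauss.
Variables (A : idomainType) (mu : A -> nat).
Hypothesis mu_lt : division_measure mu.
Hypothesis prime_div : has_prime_divisors A.
Implicit Types (p c : A) (f g h k : {poly A}).

Lemma prime_first_coef p f : ~ divides p%:P f ->
  exists2 i, ~ divides p f`_i & forall j, (j < i)%N -> divides p f`_j.
Proof.
elim/poly_ind: f => [|f c IH] ndiv.
  by case: ndiv; exists 0; rewrite mulr0.
have [[x cx]|Npc] := pselect (divides p c); last first.
  by exists 0%N => //; rewrite coefD coefMX coefC /= add0r.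
have [|i Ni lti] := IH.
  move=> [g fg]; apply: ndiv; exists (g * 'X + x%:P).
  by rewrite fg cx mulrDr mulrA polyCM.
exists i.+1; first by rewrite coefD coefMX coefC /= addr0.
move=> [_|j]; last by rewrite coefD coefMX coefC /= addr0 => /lti.
by rewrite coefD coefMX coefC /= add0r; exists x.
Qed.

Lemma divides_sum (I : Type) (r : seq I) (P : pred I) (F : I -> A) p :
  (forall i, P i -> divides p (F i)) -> divides p (\sum_(i <- r | P i) F i).
Proof.
move=> pF; elim/big_ind: _ => //; first by exists 0; rewrite mulr0.
by move=> _ _ [x ->] [y ->]; exists (x + y); rewrite mulrDr.
Qed.

(** Gauss's argument: let [i] and [j] index the first coefficients of [f] and [g] that [p] does not
    divide. In coefficient [i + j] of the product, every other term has a left index below [i] or a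
    right index below [j], so [p] divides it. *)
Lemma prime_element_polyC p : prime_element p -> prime_element p%:P.
Proof.
move=> [p0 pNu pp]; split; first by rewrite polyC_eq0.
  by rewrite poly_unitE negb_and coefC /= pNu orbT.
move=> f g [h fgh].
have [|Nf] := pselect (divides p%:P f); first by left.
have [|Ng] := pselect (divides p%:P g); first by right.
have [i Ni lti] := prime_first_coef Nf.
have [j Nj ltj] := prime_first_coef Ng.
have : divides p (f`_i * g`_j); last by case/pp.
have ltij : (i < (i + j).+1)%N by rewrite ltnS leq_addr.
have -> : f`_i * g`_j = (f * g)`_(i + j)
    - \sum_(l < (i + j).+1 | l != Ordinal ltij) f`_l * g`_(i + j - l).
  by rewrite coefM (bigD1 (Ordinal ltij)) //= addKn addrK.
rewrite fgh coefCM.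
have [|x ->] := @divides_sum _ (index_enum 'I_(i + j).+1)
  (fun l => l != Ordinal ltij) (fun l => f`_l * g`_(i + j - l)) p.
  move=> l; rewrite -val_eqE /= neq_ltn => /orP[/lti[x ->]|lt_il].
    by exists (x * g`_(i + j - l)); rewrite mulrA.
  have [|x ->] := ltj (i + j - l)%N.
    by rewrite ltn_subLR ?ltn_add2r // -ltnS.
  by exists (f`_l * x); rewrite mulrCA.
by exists (h`_(i + j) - x); rewrite mulrBr.
Qed.

(** Phrased with prime constants, so that no gcd of the coefficients has to exist. *)
Definition primitive f := forall p, prime_element p -> ~ divides p%:P f.

Lemma divides_prime_factor c : c != 0 -> c \isn't a GRing.unit ->
  exists p c', [/\ prime_element p, c = p * c', c' != 0 & (mu c' < mu c)%N].
Proof.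
move=> c0 cNu; have [p pp [c' ec]] := prime_div c0 cNu.
exists p, c'; split=> //.
  by apply: contraNneq c0 => c'0; rewrite ec c'0 mulr0.
by rewrite ec mu_lt -?ec //; case: pp.
Qed.

(** Each prime constant taken out of [f] lowers the measure of the leading coefficient. *)
Lemma primitive_part f : f != 0 ->
  exists c g, [/\ f = c%:P * g, size g = size f & primitive g].
Proof.
have [k] := ubnP (mu (lead_coef f)); elim: k f => // k IH f.
rewrite ltnS => le_f f0.
have [[p [pp [g fg]]]|prim] :=
    pselect (exists p, prime_element p /\ divides p%:P f); last first.
  exists 1, f; rewrite mul1r; split=> // p pp pf; apply: prim; by exists p.
have [p0 pNu _] := pp.
have g0 : g != 0 by apply: contraNneq f0; rewrite fg => ->; rewrite mulr0.
have [|c [h [gch szh ph]]] := IH g _ g0.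
  apply: leq_trans le_f; rewrite fg lead_coefM lead_coefC mu_lt //.
  by rewrite mulf_neq0 // lead_coef_eq0.
exists (p * c), h; split=> //; first by rewrite fg gch mulrA polyCM.
by rewrite szh fg size_Cmul.
Qed.

(* Over an integral domain [dvdp] is divisibility up to a nonzero constant, that
   is, over the fraction field. *)
Lemma primitive_dvdp g f : primitive g -> Pdiv.Idomain.dvdp g f -> divides g f.
Proof.
move=> pg /Pdiv.Idomain.dvdpP[[c k] /= c0]; rewrite -mul_polyC.
(* The primes of [c] are cancelled one by one: each divides [k * g], hence [k], since [g] is
   primitive. *)
have [n] := ubnP (mu c); elim: n c k c0 => // n IH c k c0.
rewrite ltnS => le_c e.
have [cu|cNu] := boolP (c \is a GRing.unit).
  exists (c^-1%:P * k); rewrite mulrCA [g * k]mulrC -e mulrA -polyCM.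
  by rewrite mulVr // mul1r.
have [p [c' [pp ec c'0 lt_c]]] := divides_prime_factor c0 cNu.
have [_ _ pdiv] := prime_element_polyC pp.
have [|[k' ek]|/(pg p pp) //] := pdiv k g.
  by exists (c'%:P * f); rewrite -e ec polyCM mulrA.
apply: (IH c' k') => //; first exact: leq_trans lt_c le_c.
apply: (@mulfI _ p%:P); first by rewrite polyC_eq0; case: pp.
by rewrite mulrA -polyCM -ec e ek mulrA.
Qed.

(** The gcd over the fraction field, once made primitive, divides [f] and [g] over [A] itself. It is
    then a unit, hence of size 1. *)
Lemma coprime_elements_coprimep f g : f != 0 ->
  coprime_elements f g -> Pdiv.Idomain.coprimep f g.
Proof.
move=> f0 co; rewrite Pdiv.Idomain.coprimep_def.
have d0 : Pdiv.Idomain.gcdp f g != 0.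
  by rewrite Pdiv.Idomain.gcdp_eq0 (negPf f0).
have [c [d [ed <- pd]]] := primitive_part d0.
have dvd_d h : Pdiv.Idomain.dvdp (Pdiv.Idomain.gcdp f g) h -> divides d h.
  move=> dh; apply: primitive_dvdp => //; apply: Pdiv.Idomain.dvdp_trans dh.
  by rewrite ed Pdiv.Idomain.dvdp_mull.
have := coprime_divides_unit co (dvd_d _ (Pdiv.Idomain.dvdp_gcdl f g))
  (dvd_d _ (Pdiv.Idomain.dvdp_gcdr f g)).
by rewrite poly_unitE => /andP[].
Qed.

Lemma euclid_lemma_poly : euclid_lemma {poly A}.
Proof.
move=> f g h co fgh; have [q eq_fgh] := fgh.
have [f0|f0] := eqVneq f 0.
  move: eq_fgh; rewrite f0 mul0r => /eqP; rewrite mulf_eq0 => /orP[]/eqP e0.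
    (* Two zeros are not coprime, as 0 is a common factor and not a unit. *)
    by have := co 0 0 0; rewrite f0 e0 mulr0 unitr0 => /(_ erefl erefl).
  by exists 0; rewrite e0 mulr0.
have: Pdiv.Idomain.dvdp f h.
  rewrite -(Pdiv.Idomain.Gauss_dvdpr _ (coprime_elements_coprimep f0 co)).
  by rewrite eq_fgh Pdiv.Idomain.dvdp_mulr.
case/Pdiv.Idomain.dvdpP => [[c k] /= c0]; rewrite -mul_polyC => e {fgh}.
(* Now [c * h = k * f] with [c] a nonzero constant, whose primes are removed. A prime [p] of [c]
   divides [k] or [f]. In the first case it is cancelled from [c] and [k]. In the second it does not
   divide [g], so it divides [h] and is cancelled from [f] and [h]. The sum of measures drops in
   both cases. *)
have [n] := ubnP (mu c + mu (lead_coef f))%N.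
elim: n c k f h q c0 f0 co eq_fgh e => // n IH c k f h q c0 f0 co efgh e.
rewrite ltnS => le_n.
have [cu|cNu] := boolP (c \is a GRing.unit).
  exists (c^-1%:P * k); rewrite mulrCA [f * k]mulrC -e mulrA -polyCM.
  by rewrite mulVr // mul1r.
have [p [c' [pp ec c'0 lt_c]]] := divides_prime_factor c0 cNu.
have [p0 pNu _] := pp.
have [pP0 pPNu pdiv] := prime_element_polyC pp.
have [|[k' ek]|[f' ef]] := pdiv k f.
- by exists (c'%:P * h); rewrite -e ec polyCM mulrA.
- apply: (IH c' k' f h q) => //.
    apply: (@mulfI _ p%:P) => //.
    by rewrite mulrA -polyCM -ec e ek mulrA.
  by apply: leq_trans le_n; rewrite ltn_add2r.
have f'0 : f' != 0 by apply: contraNneq f0; rewrite ef => ->; rewrite mulr0.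
have [|pg|[h' eh]] := pdiv g h.
- by exists (f' * q); rewrite efgh ef mulrA.
- by case/negP: pPNu; apply: coprime_divides_unit co _ pg; exists f'.
have [||||x h'x] := IH c k f' h' q c0 f'0.
- by apply: coprime_elements_divl co; exists p%:P; rewrite mulrC.
- by apply: (@mulfI _ p%:P) => //; rewrite mulrCA -eh efgh ef mulrA.
- by apply: (@mulfI _ p%:P) => //; rewrite mulrCA -eh e ef mulrCA.
- apply: leq_trans le_n; rewrite ltn_add2l ef lead_coefM lead_coefC mu_lt //.
  by rewrite mulf_neq0 // lead_coef_eq0.
by exists x; rewrite eh h'x ef mulrA.
Qed.

End PolyGauss.

(** * Multivariate polynomials *)

Section MpolyAsPoly.
Variables (F : fieldType) (n : nat).

(** The inverse of [muni], composed of ring morphisms so that it is one by construction. *)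
Definition mmulti_rmorph : {poly {mpoly F[n]}} -> {mpoly F[n.+1]} :=
  horner_eval 'X_ord_max \o map_poly (@mwiden n F).

HB.instance Definition _ := GRing.RMorphism.on mmulti_rmorph.

Lemma mmulti_rmorphC q : mmulti_rmorph q%:P = mwiden q.
Proof. by rewrite /mmulti_rmorph /= map_polyC /= /horner_eval hornerC. Qed.

Lemma mmulti_rmorphX : mmulti_rmorph 'X = 'X_ord_max.
Proof. by rewrite /mmulti_rmorph /= map_polyX /horner_eval hornerX. Qed.

Lemma muniK : cancel (@muni n F) mmulti_rmorph.
Proof.
move=> p; rewrite muniE raddf_sum [RHS]mpolyE /=.
apply: eq_bigr => m _; rewrite -mul_polyC rmorphM rmorphXn /=.
rewrite mmulti_rmorphC mmulti_rmorphX mwidenZ mwidenX -scalerAl; congr (_ *: _).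
rewrite [RHS]mpolyXE_id mpolyXE_id big_ord_recr /= mnmwiden_ordmax expr0 mulr1.
rewrite [RHS]big_ord_recr; congr (_ * _).
by apply: eq_bigr => i _; rewrite mnmwiden_widen mnmE.
Qed.

Lemma muni_mwiden q : muni (mwiden q) = q%:P :> {poly {mpoly F[n]}}.
Proof.
rewrite {1 2}[q]mpolyE (raddf_sum (@mwiden n F)) (raddf_sum (@muni n F)).
rewrite (raddf_sum polyC).
apply: eq_bigr => m _ /=; rewrite mwidenZ muniZ mwidenX muniE msuppX big_seq1.
rewrite mcoeffX eqxx scale1r mnmwiden_ordmax expr0 alg_polyC -mul_polyC -polyCM.
congr (_%:P); rewrite mul_mpolyC; congr (_ *: 'X_[_]).
by apply/mnmP => i; rewrite mnmE mnmwiden_widen.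
Qed.

Lemma muniXmax : muni 'X_ord_max = 'X :> {poly {mpoly F[n]}}.
Proof.
rewrite muniE msuppX big_seq1 mcoeffX eqxx scale1r mnm1E eqxx.
rewrite (_ : [multinom _ | _ < _] = 0%MM) ?mpolyX0 ?scale1r //.
apply/mnmP => i; rewrite mnmE mnm1E mnm0E -val_eqE /=.
by rewrite gtn_eqF.
Qed.

Lemma mmulti_rmorphK : cancel mmulti_rmorph (@muni n F).
Proof.
elim/poly_ind => [|p c IH]; first by rewrite !rmorph0.
by rewrite !(rmorphD, rmorphM) /= IH mmulti_rmorphX mmulti_rmorphC
  muni_mwiden muniXmax.
Qed.

End MpolyAsPoly.

(** * Euclid's lemma in several variables *)

Section MpolyDivisibility.
Variable F : fieldType.

Lemma mpoly_const_unit n (p : {mpoly F[n]}) :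
  p != 0 -> (msize p <= 1)%N -> p \is a GRing.unit.
Proof.
move=> p0; rewrite leq_eqVlt ltnS leqn0 msize_poly_eq0 (negPf p0) orbF.
case/msize_poly1P => c c0 ->; apply: (rmorph_unit (@mpolyC n F)).
by rewrite unitfE.
Qed.

Lemma msize_division_measure n :
  division_measure (fun p : {mpoly F[n]} => msize p).
Proof.
move=> a b aNu; rewrite mulf_eq0 negb_or => /andP[a0 b0].
have : (1 < msize a)%N.
  by rewrite ltnNge; apply: contra aNu; apply: mpoly_const_unit.
rewrite msizeM // (mpolySpred _ a0) (mpolySpred _ b0) addSn addnS /= !ltnS.
by rewrite -[X in _ -> (X < _)%N]add0n ltn_add2r.
Qed.

Lemma euclid_lemma_mpoly n : euclid_lemma {mpoly F[n]}.
Proof.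
elim: n => [|n IH] a b c co [d e].
  (* Without variables every nonzero polynomial is a constant, hence a unit. *)
  have [a0|a0] := eqVneq a 0; last first.
    exists (a^-1 * c); rewrite mulrA divrr ?mul1r // mpoly_const_unit //.
    rewrite msizeE; apply/bigmax_leqP_seq => m _ _.
    by rewrite mdegE big_ord0.
  move: e; rewrite a0 mul0r => /eqP; rewrite mulf_eq0 => /orP[]/eqP e0.
    by have := co 0 0 0; rewrite a0 e0 mulr0 unitr0 => /(_ erefl erefl).
  by exists 0; rewrite e0 mulr0.
(* Coprimality is carried across the isomorphism [muni]. *)
have co' : coprime_elements (muni a) (muni b).
  move=> x y z ex ey.
  have xu : mmulti_rmorph x \is a GRing.unit.
    apply: (co _ (mmulti_rmorph y) (mmulti_rmorph z)).
      by rewrite -rmorphM -ex; apply/esym/muniK.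
    by rewrite -rmorphM -ey; apply/esym/muniK.
  apply/unitrPr; exists (muni (mmulti_rmorph x)^-1).
  by rewrite -{1}(mmulti_rmorphK x) -muniM divrr // muni1.
have [||x ex] := euclid_lemma_poly (@msize_division_measure n) _ co'
    (c := muni c).
- exact: has_prime_divisors_euclid (@msize_division_measure n) IH.
- exists (muni d); move/(congr1 (@muni n F)): e => e.
  by rewrite !muniM in e.
by exists (mmulti_rmorph x); rewrite -(muniK c) ex rmorphM /= muniK.
Qed.

End MpolyDivisibility.

(** * Points where a polynomial does not vanish *)

Section MpolyEvaluation.
Variable F : numFieldType.

(** In characteristic 0 the naturals below [size p] are distinct, and too many to be all roots. *)
Lemma poly_nonroot (p : {poly F}) : p != 0 -> exists x, p.[x] != 0.
Proof.
move=> p0; have [//|nx] := pselect (exists x, p.[x] != 0).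
have := max_poly_roots p0 (rs := [seq i%:R | i <- iota 0 (size p)]).
rewrite size_map size_iota ltnn => H; suff: false by []; apply: H.
  by apply/allP => x _; apply/negPn/negP => px; apply: nx; exists x.
rewrite map_inj_uniq ?iota_uniq // => i j /eqP.
by rewrite Num.Theory.eqr_nat => /eqP.
Qed.

Lemma meval_mmulti_rmorph n (P : {poly {mpoly F[n]}}) (v : 'I_n.+1 -> F) :
  (mmulti_rmorph P).@[v]
  = (map_poly (meval (fun i => v (widen_ord (leqnSn n) i))) P).[v ord_max].
Proof.
elim/poly_ind: P => [|P c IH]; first by rewrite !rmorph0 horner0.
rewrite !(rmorphD, rmorphM) /= IH mmulti_rmorphX mmulti_rmorphC mevalXU.
rewrite map_polyX map_polyC /= hornerD hornerM hornerX hornerC; congr (_ + _).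
rewrite {1 2}[c]mpolyE (raddf_sum (@mwiden n F)) !(raddf_sum (meval _)).
apply: eq_bigr => m _ /=; rewrite mwidenZ mwidenX !mevalZ !mevalX.
rewrite big_ord_recr /= mnmwiden_ordmax expr0 mulr1; congr (_ * _).
by apply: eq_bigr => i _; rewrite mnmwiden_widen.
Qed.

(** Induction on the variables: the first coordinates are chosen off the zeros of the leading
    coefficient in the last variable, then the last coordinate off the roots of the resulting
    polynomial. *)
Lemma mpoly_nonroot n (p : {mpoly F[n]}) : p != 0 -> exists v, p.@[v] != 0.
Proof.
elim: n p => [|n IH] p p0.
  exists (fun=> 0); have [|c c0 ->] := msize_poly1P p _; last by rewrite mevalC.
  rewrite eqn_leq lt0n msize_poly_eq0 p0 andbT msizeE.
  by apply/bigmax_leqP_seq => m _ _; rewrite mdegE big_ord0.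
have P0 : muni p != 0.
  by apply: contraNneq p0 => P0; rewrite -(muniK p) P0 rmorph0.
have [w lw] : exists w, (lead_coef (muni p)).@[w] != 0.
  by apply: IH; rewrite lead_coef_eq0.
have [x] : exists x, (map_poly (meval w) (muni p)).[x] != 0.
  apply: poly_nonroot; apply: contraNneq lw => /polyP/(_ (size (muni p)).-1).
  by rewrite coef_map coef0 /= => ->.
pose v i := if unlift ord_max i is Some j then w j else x.
exists v; rewrite -(muniK p) meval_mmulti_rmorph /v unlift_none.
rewrite (eq_map_poly (g := meval w)) // => q; apply: meval_eq => i.
rewrite (_ : widen_ord _ i = lift ord_max i) ?liftK //.
by apply: val_inj; apply: esym; apply: lift_max.
Qed.

End MpolyEvaluation.

(** * Regular functions on a linear group *)

Section RegularFunctions.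
Variables (R : realType) (m : nat) (G : 'M[R[i]]_m -> Prop).
Hypothesis G_unit : forall g, G g -> g \in unitmx.
Local Notation C := R[i].
Implicit Types f : 'M[C]_m -> C.

Lemma regular_on_ext f f' :
  (forall g, G g -> f g = f' g) -> regular_on G f -> regular_on G f'.
Proof. by move=> e [p [k H]]; exists p, k => g Gg; rewrite -e // H. Qed.

Lemma regular_on_mpoly (p : {mpoly C[m * m]}) :
  regular_on G (fun g => p.@[entries g]).
Proof. by exists p, 0%N => g _; rewrite expr0 divr1. Qed.

Lemma regular_on_const (c : C) : regular_on G (fun=> c).
Proof.
by apply: regular_on_ext (regular_on_mpoly c%:MP) => g _; rewrite mevalC.
Qed.

Lemma regular_on_entry i j : regular_on G (fun g => g i j).
Proof.
apply: regular_on_ext (regular_on_mpoly 'X_(mxvec_index i j)) => g _.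
by rewrite mevalXU /entries mxvecE.
Qed.

Lemma mpoly_det : exists D : {mpoly C[m * m]},
  forall g : 'M[C]_m, D.@[entries g] = \det g.
Proof.
exists (\det (\matrix_(i, j) 'X_(mxvec_index i j))) => g.
rewrite -(det_map_mx (meval (entries g))) /=; congr (\det _).
by apply/matrixP => i j; rewrite !mxE mevalXU /entries mxvecE.
Qed.

Lemma det_unit_neq0 g : G g -> \det g != 0.
Proof. by move=> /G_unit; rewrite unitmxE unitfE. Qed.

Lemma regular_onD f f' :
  regular_on G f -> regular_on G f' -> regular_on G (fun g => f g + f' g).
Proof.
move=> [p [k Hf]] [q [l Hq]]; have [D HD] := mpoly_det.
exists (p * D ^+ l + q * D ^+ k), (k + l)%N => g Gg.
rewrite Hf // Hq // mevalD !mevalM !rmorphXn /= !HD.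
by rewrite addf_div ?expf_neq0 ?det_unit_neq0 // -exprD.
Qed.

Lemma regular_onM f f' :
  regular_on G f -> regular_on G f' -> regular_on G (fun g => f g * f' g).
Proof.
move=> [p [k Hf]] [q [l Hq]]; exists (p * q), (k + l)%N => g Gg.
by rewrite Hf // Hq // mevalM mulf_div -exprD.
Qed.

Lemma regular_onX f k : regular_on G f -> regular_on G (fun g => f g ^+ k).
Proof.
move=> Hf; elim: k => [|k IH]; first exact: regular_on_const.
by apply: regular_on_ext (regular_onM Hf IH) => g _; rewrite exprS.
Qed.

Lemma regular_on_sum (I : Type) (r : seq I) (F : I -> 'M[C]_m -> C) :
  (forall i, regular_on G (F i)) ->
  regular_on G (fun g => \sum_(i <- r) F i g).
Proof.
move=> HF; elim: r => [|i r IH].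
  by apply: regular_on_ext (regular_on_const 0) => g _; rewrite big_nil.
by apply: regular_on_ext (regular_onD (HF i) IH) => g _; rewrite big_cons.
Qed.

Lemma regular_on_prod (I : Type) (r : seq I) (F : I -> 'M[C]_m -> C) :
  (forall i, regular_on G (F i)) ->
  regular_on G (fun g => \prod_(i <- r) F i g).
Proof.
move=> HF; elim: r => [|i r IH].
  by apply: regular_on_ext (regular_on_const 1) => g _; rewrite big_nil.
by apply: regular_on_ext (regular_onM (HF i) IH) => g _; rewrite big_cons.
Qed.

Lemma regular_on_meval n (p : {mpoly C[n]}) (x : 'I_n -> 'M[C]_m -> C) :
  (forall i, regular_on G (x i)) ->
  regular_on G (fun g => p.@[fun i => x i g]).
Proof.
move=> Hx.
apply: (@regular_on_ext
  (fun g => \sum_(a <- msupp p) p@_a * \prod_i x i g ^+ a i)).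
  by move=> g _; rewrite mevalE.
apply: regular_on_sum => a; apply: regular_onM; first exact: regular_on_const.
by apply: regular_on_prod => i; apply: regular_onX.
Qed.

Lemma regular_on_det n (M : 'M[C]_m -> 'M[C]_n) :
  (forall i j, regular_on G (fun g => M g i j)) ->
  regular_on G (fun g => \det (M g)).
Proof.
move=> HM; apply: regular_on_sum => s.
apply: regular_onM; first exact: regular_on_const.
by apply: regular_on_prod => i.
Qed.

(** Cramer's rule: cofactors are polynomial in the entries, and the inverse determinant is
    regular. *)
Lemma regular_on_invmx i j : regular_on G (fun g => invmx g i j).
Proof.
apply: (@regular_on_ext (fun g => (\det g)^-1 * cofactor g j i)).
  by move=> g /G_unit gU; rewrite /invmx gU !mxE.
apply: regular_onM.
  by exists 1, 1%N => g Gg; rewrite meval1 expr1 mul1r.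
apply: regular_onM; first exact: regular_on_const.
apply: regular_on_det => k l; apply: regular_on_ext (regular_on_entry _ _).
by move=> g _; rewrite !mxE.
Qed.

Lemma regular_on_comp_invmx f :
  (forall g, G g -> G (invmx g)) ->
  regular_on G f -> regular_on G (fun g => f (invmx g)).
Proof.
move=> Ginv [p [k Hf]].
(* Dividing by a power of the determinant of the inverse is multiplying by that power of
   [\det g]. *)
apply: (@regular_on_ext (fun g => p.@[entries (invmx g)] * (\det g) ^+ k)).
  by move=> g Gg; rewrite Hf ?det_inv ?exprVn ?invrK //; apply: Ginv.
apply: regular_onM; last first.
  by apply/regular_onX/regular_on_det => i j; apply: regular_on_entry.
apply: (@regular_on_meval _ p (fun i g => entries (invmx g) i)) => i.
case/mxvec_indexP: i => i j; apply: regular_on_ext (regular_on_invmx i j).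
by move=> g _; rewrite /entries mxvecE.
Qed.

End RegularFunctions.

(** * Relative invariants *)

Section RationalFunctions.
Variables (R : realType) (n : nat).
Local Notation C := R[i].
Implicit Types (p q : {mpoly C[n]}) (v : 'cV[C]_n).

Lemma tofrac_neq0 q v :
  q.@[coords v] != 0 -> q%:F != 0 :> {fraction {mpoly C[n]}}.
Proof.
by move=> qv; rewrite tofrac_eq0; apply: contraNneq qv => ->; rewrite meval0.
Qed.

(** Cross-multiplication shows that the value does not depend on the fraction chosen to represent
    the function. *)
Lemma has_valueP p q v c :
  q.@[coords v] != 0 -> has_value (p%:F / q%:F) v c ->
  c = p.@[coords v] / q.@[coords v].
Proof.
move=> qv [p' [q' [q'v e ->]]]; apply/eqP; rewrite eqr_div //.
move/eqP: e; rewrite eqr_div ?(tofrac_neq0 (v := v)) // -!tofracM tofrac_eq.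
by move=> /eqP e; rewrite -!mevalM -e mulrC.
Qed.

Lemma has_value_poly p v c : has_value p%:F v c -> c = p.@[coords v].
Proof.
have -> : p%:F = p%:F / (1 : {mpoly C[n]})%:F by rewrite tofrac1 divr1.
by move/has_valueP; rewrite meval1 divr1; apply; apply: oner_neq0.
Qed.

Definition linear_subst (A : 'M[C]_n) p : {mpoly C[n]} :=
  p \mPo [tuple \sum_j A i j *: 'X_j | i < n].

Lemma meval_linear_subst A p v :
  (linear_subst A p).@[coords v] = p.@[coords (A *m v)].
Proof.
rewrite comp_mpoly_meval; apply: meval_eq => i.
rewrite tnth_mktuple raddf_sum /coords mxE /=.
by apply: eq_bigr => j _; rewrite mevalZ mevalXU.
Qed.

(** Additivity of degrees as an upper bound, valid also for the zero polynomial, whose [msize] is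
    0. *)
Lemma msizeM_leS d e p q : (msize p <= d.+1)%N -> (msize q <= e.+1)%N ->
  (msize (p * q) <= (d + e).+1)%N.
Proof.
have [-> | p0] := eqVneq p 0; first by rewrite mul0r msize0.
have [-> | q0] := eqVneq q 0; first by rewrite mulr0 msize0.
rewrite msizeM // (mpolySpred _ p0) (mpolySpred _ q0) addSn addnS /= !ltnS.
exact: leq_add.
Qed.

(** A monomial of degree d becomes a product of d linear forms, some possibly zero. *)
Lemma msize_linear_subst A p : (msize (linear_subst A p) <= msize p)%N.
Proof.
rewrite /linear_subst comp_mpolyEX.
apply: leq_trans (msize_sum _ _ _) _.
apply/bigmax_leqP_seq => a a_p _.
apply: leq_trans (msizeZ_le _ _) _.
apply: leq_trans (msize_mdeg_lt a_p).
rewrite comp_mpolyX mdegE.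
elim/big_rec2: _ => [|i d q _ le_q]; first by rewrite msize1.
apply: msizeM_leS => //; elim: (a i) => [|k IH]; first by rewrite msize1.
rewrite exprS; apply: (@msizeM_leS 1 k) => //; rewrite tnth_mktuple.
apply: leq_trans (msize_sum _ _ _) _.
apply/bigmax_leqP => j _; apply: leq_trans (msizeZ_le _ _) _.
by rewrite msizeX mdeg1.
Qed.

Lemma dhomog_msize_le d p : p \is d.-homog -> (msize p <= d.+1)%N.
Proof.
move=> /dhomogP hp; rewrite msizeE; apply/bigmax_leqP_seq => a a_p _.
by rewrite ltnS (hp a a_p).
Qed.

(** Some equation [q] of the complement of [U] is a nonzero polynomial. If [p] were nonzero too,
    [p * q] would be nonzero at some point; that point lies in [U], where [p] vanishes. *)
Lemma zariski_dense (U : 'cV[C]_n -> Prop) p :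
  zariski_open U -> (exists v, U v) -> (forall v, U v -> p.@[coords v] = 0) ->
  p = 0.
Proof.
move=> [S HS] [v0 /HS Uv0] p0.
have [q [Sq q0]] : exists q, S q /\ q.@[coords v0] != 0.
  have [//|nq] := pselect (exists q, S q /\ q.@[coords v0] != 0).
  by case: Uv0 => q Sq; apply/eqP/negPn/negP => q0; apply: nq; exists q.
have [//|pn0] := eqVneq p 0.
have qn0 : q != 0 by apply: contraNneq q0 => ->; rewrite meval0.
have [w] := mpoly_nonroot (mulf_neq0 pn0 qn0).
pose v : 'cV[C]_n := \col_i w i.
have -> : (p * q).@[w] = p.@[coords v] * q.@[coords v].
  by rewrite mevalM; congr (_ * _); apply: meval_eq => i; rewrite /coords mxE.
rewrite mulf_eq0 negb_or => /andP[pv qv].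
case/eqP: pv; apply: p0; apply/HS => /(_ q Sq) /eqP.
by rewrite (negPf qv).
Qed.

End RationalFunctions.

(** * The group action on the open orbit *)

Section Prehomogeneous.
Variables (R : realType) (m n : nat).
Local Notation C := R[i].
Variables (G : 'M[C]_m -> Prop) (rho : 'M[C]_m -> 'M[C]_n).
Variable Omega : 'cV[C]_n -> Prop.
Hypothesis PV : prehomogeneous G rho Omega.
Implicit Types (f alpha beta : {mpoly C[n]}) (g h : 'M[C]_m) (v w : 'cV[C]_n).

Lemma group_unit g : G g -> g \in unitmx.
Proof. by case: PV => -[[S HS] _ _ _] _ _ _ _ /HS[]. Qed.

Lemma orbit_stable v g : Omega v -> G g -> Omega (rho g *m v).
Proof.
case: PV => -[_ _ GM _] _ [_ rhoM _] [v0 orb] _ /orb[h Gh ->] Gg.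
by apply/orb; exists (g *m h); [exact: GM | rewrite mulmxA rhoM].
Qed.

Lemma orbit_transitive v w : Omega v -> Omega w ->
  exists2 g, G g & w = rho g *m v.
Proof.
case: PV => -[_ _ GM GV] _ [_ rhoM _] [v0 orb] _ /orb[h Gh ->] /orb[k Gk ->].
exists (k *m invmx h); first by apply: GM => //; apply: GV.
rewrite mulmxA -rhoM ?mulmxKV ?group_unit //.
by apply: GM => //; apply: GV.
Qed.

Lemma orbit_nonempty : exists v, Omega v.
Proof.
case: PV => -[_ G1 _ _] _ _ [v0 orb] _.
by exists (rho 1%:M *m v0); apply/orb; exists 1%:M.
Qed.

Lemma orbit_dense f : (forall v, Omega v -> f.@[coords v] = 0) -> f = 0.
Proof.
by case: PV => _ _ _ _ Oopen; apply: zariski_dense Oopen orbit_nonempty.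
Qed.

Lemma relative_invariant_eq f : relative_invariant G rho Omega f%:F ->
  exists2 chi, rational_character G chi & forall v g, Omega v -> G g ->
    f.@[coords (rho g *m v)] = chi g * f.@[coords v].
Proof.
move=> [_ [chi Hchi inv]]; exists chi => // v g Ov Gg.
by have [a [b [/has_value_poly <- /has_value_poly <- ->]]] := inv v g Ov Gg.
Qed.

(** A zero at one point of the orbit spreads by transitivity to the whole orbit, which is dense. *)
Lemma relative_invariant_neq0 f v :
  relative_invariant G rho Omega f%:F -> Omega v -> f.@[coords v] != 0.
Proof.
move=> inv Ov; have [f0 _] := inv.
apply: contraNneq f0 => fv; rewrite tofrac_eq0; apply/eqP/orbit_dense => w Ow.
have [chi _ fE] := relative_invariant_eq inv.
by have [g Gg ->] := orbit_transitive Ov Ow; rewrite fE // fv mulr0.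
Qed.

Lemma regular_on_action f v :
  regular_on G (fun g => f.@[coords (rho g *m v)]).
Proof.
case: PV => _ _ [_ _ rhoR] _ _.
apply: (regular_on_meval group_unit f (x := fun i g => coords (rho g *m v) i)).
move=> i; apply: (@regular_on_ext _ _ _ (fun g => \sum_j rho g i j * v j 0)).
  by move=> g _; rewrite /coords mxE.
apply: (regular_on_sum group_unit) => j; apply: (regular_onM) => //.
exact: regular_on_const.
Qed.

(** The inverse of [chi g] is [chi (invmx g)], and inversion is a regular map. *)
Lemma regular_on_character_inv chi :
  rational_character G chi -> regular_on G (fun g => (chi g)^-1).
Proof.
case: PV => -[_ G1 _ GV] _ _ _ _ [chi0 chiM chiR].
apply: regular_on_ext (regular_on_comp_invmx group_unit GV chiR) => g Gg.
have chi1 : chi 1%:M = 1.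
  by apply: (mulfI (chi0 _ G1)); rewrite -chiM // mulmx1 mulr1.
apply: (mulfI (chi0 _ Gg)); rewrite -chiM ?mulmxV ?chi1 ?divff ?chi0 //.
- exact: group_unit.
- exact: GV.
Qed.

(** * Additive invariance of one summand *)

Section Summand.
Variables h1 f1 f2 alpha beta : {mpoly C[n]}.
Hypothesis hadd :
  additive_relative_invariant G rho Omega (h1%:F / (f1 * f2)%:F).
Hypothesis inv1 : relative_invariant G rho Omega f1%:F.
Hypothesis inv2 : relative_invariant G rho Omega f2%:F.
Hypothesis co : coprime_elements f1 f2.
Hypothesis le_alpha : (msize alpha <= msize f1)%N.
Hypothesis h1E : h1 = alpha * f2 + beta * f1.

Let F v := alpha.@[coords v] / f1.@[coords v].

Lemma summand_increment_const g : G g ->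
  exists c, forall v, Omega v -> F (rho g *m v) - F v = c.
Proof.
move=> Gg; have [Phi _ HPhi] := hadd.
have [chi1 [chi1n0 _ _] f1E] := relative_invariant_eq inv1.
have [chi2 [chi2n0 _ _] f2E] := relative_invariant_eq inv2.
(* As [rho g] multiplies [f1] by [chi1 g], the quotient [A / f1] is the increment of [alpha / f1];
   likewise for [B / f2]. *)
pose A : {mpoly C[n]} := (chi1 g)^-1 *: linear_subst (rho g) alpha - alpha.
pose B : {mpoly C[n]} := (chi2 g)^-1 *: linear_subst (rho g) beta - beta.
have AE v : A.@[coords v]
    = (chi1 g)^-1 * alpha.@[coords (rho g *m v)] - alpha.@[coords v].
  by rewrite mevalB mevalZ meval_linear_subst.
have BE v : B.@[coords v]
    = (chi2 g)^-1 * beta.@[coords (rho g *m v)] - beta.@[coords v].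
  by rewrite mevalB mevalZ meval_linear_subst.
have le_A : (msize A <= msize f1)%N.
  apply: leq_trans (msizeD_le _ _) _; rewrite msizeN geq_max le_alpha andbT.
  apply: leq_trans (msizeZ_le _ _) _.
  exact: leq_trans (msize_linear_subst _ _) le_alpha.
clearbody A B.
have f1n0 : f1 != 0 by have [] := inv1; rewrite tofrac_eq0.
have : divides f1 (f2 * A).
  (* The cofactor is read off from [A * f2 + B * f1 = Phi g *: (f1 * f2)]. *)
  exists (Phi g *: f2 - B); apply/esym/eqP; rewrite -subr_eq0; apply/eqP.
  apply: orbit_dense => v Ov; have Ogv := orbit_stable Ov Gg.
  have f1v := relative_invariant_neq0 inv1 Ov.
  have f2v := relative_invariant_neq0 inv2 Ov.
  have f1gv := relative_invariant_neq0 inv1 Ogv.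
  have f2gv := relative_invariant_neq0 inv2 Ogv.
  have [a [b [Ha Hb ab]]] := HPhi v g Ov Gg.
  move: ab; rewrite (has_valueP _ Ha) ?mevalM ?mulf_neq0 //.
  rewrite (has_valueP _ Hb) ?mevalM ?mulf_neq0 //.
  rewrite h1E !(mevalN, mevalD, mevalM, mevalZ) AE BE f1E // f2E // => <-.
  have := chi1n0 g Gg; have := chi2n0 g Gg.
  move: f1v f2v; rewrite /F.
  move: (f1.@[_]) (f2.@[_]) (chi1 g) (chi2 g) => x y c d x0 y0 d0 c0.
  by field; rewrite c0 d0 y0 x0.
case/(euclid_lemma_mpoly co) => e Ae.
have le_e : (msize e <= 1)%N.
  have [->|e0] := eqVneq e 0; first by rewrite msize0.
  move: le_A; rewrite Ae msizeM // (mpolySpred _ f1n0) (mpolySpred _ e0).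
  rewrite addSn addnS /=.
  by rewrite !ltnS -[X in (_ <= X)%N]addn0 leq_add2l.
(* The quotient [e] has size at most 1, so it equals its constant coefficient. *)
exists e@_0 => v Ov; rewrite /F f1E // invfM mulrA.
rewrite [_ / chi1 g]mulrC -mulrBl -AE Ae mevalM (msize1_polyC le_e) mevalC.
by rewrite mcoeffC eqxx mulr1 mulrAC divff ?mul1r ?relative_invariant_neq0.
Qed.

Lemma additive_relative_invariant_summand :
  additive_relative_invariant G rho Omega (alpha%:F / f1%:F).
Proof.
case: PV => -[_ _ GM GV] _ [_ rhoM _] _ _; have [v0 Ov0] := orbit_nonempty.
pose Phi g := F (rho g *m v0) - F v0.
have PhiE g v : G g -> Omega v -> F (rho g *m v) - F v = Phi g.
  move=> Gg Ov; have [c Hc] := summand_increment_const Gg.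
  by rewrite Hc // /Phi Hc.
exists Phi.
  split=> [g h Gg Gh|].
    (* The increment of [g] may be taken at any orbit point; at [rho h *m v0] the sum telescopes. *)
    rewrite -(PhiE g (rho h *m v0)) //; last exact: orbit_stable.
    by rewrite /Phi rhoM // mulmxA addrA subrK.
  have [chi Hchi f1E] := relative_invariant_eq inv1.
  apply: (regular_onD group_unit); last exact: regular_on_const.
  apply: (@regular_on_ext _ _ _ (fun g => alpha.@[coords (rho g *m v0)] *
    ((chi g)^-1 * (f1.@[coords v0])^-1))).
    by move=> g Gg; rewrite /F f1E // invfM.
  apply: regular_onM; first exact: regular_on_action.
  apply: regular_onM; last exact: regular_on_const.
  exact: regular_on_character_inv.
move=> v g Ov Gg; exists (F v), (F (rho g *m v)).
split; last exact: PhiE.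
  by exists alpha, f1; split=> //; apply: relative_invariant_neq0.
exists alpha, f1; split=> //; apply: relative_invariant_neq0 => //.
exact: orbit_stable.
Qed.

End Summand.
End Prehomogeneous.

(** The hypothesis concerns the numerator and denominator of [a / c + b / d] over the common
    denominator. *)
Lemma coprime_elements_summand (A : idomainType) (a b c d : A) :
  coprime_elements (a * d + b * c) (c * d) -> coprime_elements a c.
Proof.
move=> co x a' c' ea ec; apply: (co x (a' * d + b * c') (c' * d)).
  by rewrite ea ec mulrDr !mulrA [b * x]mulrC.
by rewrite ec mulrA.
Qed.

Theorem proposition3p17 (R : realType) (m n : nat)
    (G : 'M[R[i]]_m -> Prop) (rho : 'M[R[i]]_m -> 'M[R[i]]_n)
    (Omega : 'cV[R[i]]_n -> Prop)
    (h1 f1 f2 alpha beta : {mpoly R[i][n]})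
    (hPV : prehomogeneous G rho Omega)
    (hadd : additive_relative_invariant G rho Omega
              (h1%:F / (f1 * f2)%:F))
    (hlow : no_common_factor h1 (f1 * f2))
    (hf1 : relative_invariant G rho Omega f1%:F)
    (hf2 : relative_invariant G rho Omega f2%:F)
    (hcop : no_common_factor f1 f2)
    (halpha : alpha \is (msize f1).-1.-homog)
    (hbeta : beta \is (msize f2).-1.-homog)
    (hdec : h1%:F / (f1 * f2)%:F
            = alpha%:F / f1%:F + beta%:F / f2%:F
              :> {fraction {mpoly R[i][n]}}) :
  (additive_relative_invariant G rho Omega (alpha%:F / f1%:F) /\
   no_common_factor alpha f1) /\
  (additive_relative_invariant G rho Omega (beta%:F / f2%:F) /\
   no_common_factor beta f2).
Proof.
have f1n0 : f1 != 0 by have [] := hf1; rewrite tofrac_eq0.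
have f2n0 : f2 != 0 by have [] := hf2; rewrite tofrac_eq0.
have h1E : h1 = alpha * f2 + beta * f1.
  have nz : (f1 * f2)%:F != 0 :> {fraction {mpoly R[i][n]}}.
    by rewrite tofrac_eq0 mulf_neq0.
  move: hdec; rewrite addf_div ?tofrac_eq0 // -!tofracM -tofracD.
  by move=> /(divIf nz)/eqP; rewrite tofrac_eq => /eqP.
have h1E' : h1 = beta * f1 + alpha * f2 by rewrite addrC.
have le_alpha : (msize alpha <= msize f1)%N.
  by rewrite (mpolySpred _ f1n0) dhomog_msize_le.
have le_beta : (msize beta <= msize f2)%N.
  by rewrite (mpolySpred _ f2n0) dhomog_msize_le.
(* With the denominator reordered, the result on one summand applies to [beta / f2] as well. *)
have hadd' : additive_relative_invariant G rho Omega (h1%:F / (f2 * f1)%:F).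
  by rewrite [f2 * f1]mulrC.
split; split.
- exact: (additive_relative_invariant_summand hPV hadd hf1 hf2 hcop
    le_alpha h1E).
- by apply: (@coprime_elements_summand _ _ beta _ f2); rewrite -h1E.
- exact: (additive_relative_invariant_summand hPV hadd' hf2 hf1
    (coprime_elements_sym hcop) le_beta h1E').
- apply: (@coprime_elements_summand _ _ alpha _ f1); rewrite -h1E'.
  by rewrite mulrC.
Qed.
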